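(* Let $P\in\mathbb{C}^{p\times q}$, $Q\in\mathbb{C}^{t\times s}$, $A\in\mathbb{C}^{p\times s}$, $B\in\mathbb{C}^{t\times \ell}$, $C\in\mathbb{C}^{k\times q}$ and $D\in\mathbb{C}^{k\times \ell}$, where $\mathbb{C}^p,\mathbb{C}^q,\mathbb{C}^t,\mathbb{C}^s$ carry weights $W_p,W_q,W_t,W_s$. If $P^{[\dagger]}$ and $Q^{[\dagger]}$ exist, then $$\operatorname{rank}\left(D-CP^{[\dagger]}AQ^{[\dagger]}B\right)=\operatorname{rank}\begin{pmatrix} P^{[*]}AQ^{[*]} & P^{[*]}PP^{[*]} & 0\\ Q^{[*]}QQ^{[*]} & 0 & Q^{[*]}B\\ 0 & CP^{[*]} & -D\end{pmatrix}-\operatorname{rank}(P)-\operatorname{rank}(Q).$$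
   Context: All matrices are complex and $X^*$ denotes the complex conjugate transpose. A weight of order $n$ is an invertible Hermitian $n\times n$ matrix (not necessarily positive definite). With the given weights, the adjoints are $P^{[*]}=W_q^{-1}P^*W_p$ and $Q^{[*]}=W_s^{-1}Q^*W_t$; a square matrix $Z$ acting on a space with weight $W$ has $Z^{[*]}=W^{-1}Z^*W$. The Moore-Penrose inverse $X^{[\dagger]}$ of a matrix $X$ between weighted spaces is the unique $Y$, if it exists, satisfying $XYX=X$, $YXY=Y$, $(XY)^{[*]}=XY$ and $(YX)^{[*]}=YX$. It need not exist. *)

(* Defs.v *)
From mathcomp Require Import all_boot all_order all_algebra.
From mathcomp Require Import reals complex.

Set Implicit Arguments.
Unset Strict Implicit.
Unset Printing Implicit Defensive.

Import Order.TTheory GRing.Theory Num.Theory.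
Local Open Scope ring_scope.
Local Open Scope sesquilinear_scope.

(* Weights may be indefinite: only invertibility is required. *)
Definition is_weight (K : numClosedFieldType) (n : nat) (W : 'M[K]_n) : Prop :=
  W \is hermsymmx /\ W \in unitmx.

(* A column-vector map X : K^n -> K^m, with K^m weighted by Wm and K^n by Wn. *)
Definition wadj (K : numClosedFieldType) (m n : nat)
    (Wm : 'M[K]_m) (Wn : 'M[K]_n) (X : 'M[K]_(m, n)) : 'M[K]_(n, m) :=
  invmx Wn *m X ^t* *m Wm.

Definition is_wMPinv (K : numClosedFieldType) (m n : nat)
    (Wm : 'M[K]_m) (Wn : 'M[K]_n) (X : 'M[K]_(m, n)) (Y : 'M[K]_(n, m)) : Prop :=
  [/\ X *m Y *m X = X,
      Y *m X *m Y = Y,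
      wadj Wm Wm (X *m Y) = X *m Y &
      wadj Wn Wn (Y *m X) = Y *m X].

Lemma wadjM (K : numClosedFieldType) (n : nat) (W X Y : 'M[K]_n) :
  W \in unitmx -> wadj W W (X *m Y) = wadj W W Y *m wadj W W X.
Proof.
by move=> uW; rewrite /wadj trmx_mul map_mxM !mulmxA mulmxK.
Qed.

(* The Moore-Penrose inverse need not exist, so it is used through the relation
   [is_wMPinv]; this lemma justifies speaking of "the" inverse. *)
Lemma is_wMPinv_unique (K : numClosedFieldType) (m n : nat)
    (Wm : 'M[K]_m) (Wn : 'M[K]_n) (X : 'M[K]_(m, n)) (Y Z : 'M[K]_(n, m)) :
  is_weight Wm -> is_weight Wn ->
  is_wMPinv Wm Wn X Y -> is_wMPinv Wm Wn X Z -> Y = Z.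
Proof.
move=> [_ uWm] [_ uWn] [XYX YXY aXY aYX] [XZX ZXZ aXZ aZX].
have eXY : X *m Y = X *m Z.
  have -> : X *m Z = X *m Y *m (X *m Z) by rewrite mulmxA XYX.
  by rewrite -{2}aXY -aXZ -wadjM // mulmxA XZX aXY.
have eYX : Y *m X = Z *m X.
  have -> : Z *m X = Z *m X *m (Y *m X) by rewrite -mulmxA (mulmxA X) XYX.
  by rewrite -{2}aYX -aZX -wadjM // -mulmxA (mulmxA X) XZX aYX.
by rewrite -YXY eYX -mulmxA eXY mulmxA ZXZ.
Qed.

(* Main.v *)
Require Import Defs.
From mathcomp Require Import all_boot all_order all_algebra.
From mathcomp Require Import reals complex.

Set Implicit Arguments.
Unset Strict Implicit.
Unset Printing Implicit Defensive.

Import Order.TTheory GRing.Theory Num.Theory.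
Local Open Scope ring_scope.
Local Open Scope complex_scope.

(** Write X' for the weighted adjoint X^[*] and N for the upper left block
    of the bordered matrix.  Eliminating the border against a generalized
    inverse G of N turns the rank of the whole into rank N plus the rank of the
    Schur complement [schur_rank].  This is legitimate as soon as the border
    lies in the column and row spaces of N, even when N is singular.

    The matrix G is available in closed form.  Since X |-> X' reverses products,
    the self-adjointness of P P^+ and P^+ P reads P^+' P' = P P^+ and
    P' P^+' = P^+ P, so that P^+' P^+ P^+' inverts the block P' P P' up to
    these two projectors and P' (P^+' P^+ P^+') P' = P^+ [ginv_sandwich].
    Let GP = P^+' P^+ P^+', and GQ likewise for Q.  As N is block antitriangular with antidiagonal blocks
    P' P P' and Q' Q Q', the usual inverse of an invertible antitriangular
    matrix gives a G for which N G = diag (P^+ P, Q^+ Q) and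
    G N = diag (Q Q^+, P P^+) [antitri_mulmx_ginv, antitri_ginv_mulmx].
    Hence N has rank rank P + rank Q, the projectors fix the border because
    P^+ P P' = P' = P' P P^+ (and likewise for Q), and the Schur complement is
    - D + C (P' GP P') A (Q' GQ Q') B = - (D - C P^+ A Q^+ B). *)

(** * Ranks of block matrices *)

Section BlockRank.
Variable F : fieldType.

(** The conditions on [u] and [v] put the columns of [u] in the column space of
    [N] and the rows of [v] in its row space, so that multiplication by block
    unitriangular matrices clears them, exactly as for an invertible [N]. *)
Lemma schur_rank (m1 m2 n1 n2 : nat) (N : 'M[F]_(m1, n1)) (G : 'M_(n1, m1))
    (u : 'M_(m1, n2)) (v : 'M_(m2, n1)) (w : 'M_(m2, n2)) :
  N *m G *m u = u -> v *m G *m N = v ->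
  \rank (block_mx N u v w) = (\rank N + \rank (w - v *m G *m u)%R)%N.
Proof.
move=> NGu vGN; rewrite -rank_diag_block_mx.
set S := w - _.
have -> : block_mx N u v w =
    block_mx 1%:M 0 (v *m G) 1%:M *m block_mx N 0 0 S
      *m block_mx 1%:M (G *m u) 0 1%:M.
  rewrite !mulmx_block !(mul1mx, mulmx1, mul0mx, mulmx0, addr0, add0r) vGN.
  by rewrite !mulmxA NGu /S addrC subrK.
rewrite mxrankMfree; last first.
  by rewrite row_free_unit unitmxE det_ublock !det1 mulr1 unitr1.
rewrite -[LHS]mxrank_tr trmx_mul mxrankMfree ?mxrank_tr //.
by rewrite row_free_unit unitmx_tr unitmxE det_lblock !det1 mulr1 unitr1.
Qed.

Lemma rank_reflexive_mulmx (m n : nat) (X : 'M[F]_(m, n)) (Y : 'M_(n, m)) :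
  X *m Y *m X = X -> \rank (X *m Y) = \rank X.
Proof.
move=> XYX; apply/eqP; rewrite eqn_leq mxrankM_maxl /=.
by rewrite -{1}XYX mxrankM_maxl.
Qed.

Lemma rank_reflexive_mulmxr (m n : nat) (X : 'M[F]_(m, n)) (Y : 'M_(n, m)) :
  X *m Y *m X = X -> \rank (Y *m X) = \rank X.
Proof.
move=> XYX; apply/eqP; rewrite eqn_leq mxrankM_maxr /=.
by rewrite -{1}XYX -mulmxA mxrankM_maxr.
Qed.

(** The formula for the inverse of [block_mx X Y Z 0] when [Y] and [Z] are
    invertible, with [GY] and [GZ] in place of their inverses. *)
Definition antitri_ginv (m1 m2 n1 n2 : nat) (X : 'M[F]_(m1, n1))
    (GY : 'M[F]_(n2, m1)) (GZ : 'M[F]_(n1, m2)) : 'M[F]_(n1 + n2, m1 + m2) :=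
  block_mx 0 GZ GY (- (GY *m X *m GZ)).

(** The upper right block vanishes because the projector [Y *m GY] fixes the
    columns of [X]. *)
Lemma antitri_mulmx_ginv (m1 m2 n1 n2 : nat) (X : 'M[F]_(m1, n1))
    (Y : 'M_(m1, n2)) (Z : 'M_(m2, n1)) (GY : 'M_(n2, m1)) (GZ : 'M_(n1, m2)) :
  Y *m GY *m X = X ->
  block_mx X Y Z 0 *m antitri_ginv X GY GZ = block_mx (Y *m GY) 0 0 (Z *m GZ).
Proof.
move=> YGX; rewrite mulmx_block !(mul0mx, mulmx0, addr0, add0r).
by rewrite mulmxN !mulmxA YGX subrr.
Qed.

(** The lower left block vanishes because the projector [GZ *m Z] fixes the
    rows of [X]. *)
Lemma antitri_ginv_mulmx (m1 m2 n1 n2 : nat) (X : 'M[F]_(m1, n1))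
    (Y : 'M_(m1, n2)) (Z : 'M_(m2, n1)) (GY : 'M_(n2, m1)) (GZ : 'M_(n1, m2)) :
  X *m (GZ *m Z) = X ->
  antitri_ginv X GY GZ *m block_mx X Y Z 0 = block_mx (GZ *m Z) 0 0 (GY *m Y).
Proof.
move=> XGZ; rewrite mulmx_block !(mul0mx, mulmx0, addr0, add0r).
by rewrite mulNmx -!mulmxA XGZ subrr.
Qed.

End BlockRank.

(** * Adjoints of Moore-Penrose inverses *)

(** All that the rank formula retains of adjunction: [Xa] and [Ya] stand for the
    adjoints of [X] and of its Moore-Penrose inverse [Y], and the two projectors
    [X *m Y] and [Y *m X] are equal to their adjoints [Ya *m Xa] and
    [Xa *m Ya]. *)
Definition adjoint_ginv (F : fieldType) (m n : nat) (X : 'M[F]_(m, n))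
    (Y : 'M_(n, m)) (Xa : 'M_(n, m)) (Ya : 'M_(m, n)) : Prop :=
  [/\ X *m Y *m X = X, Y *m X *m Y = Y, Xa *m Ya *m Xa = Xa,
      Ya *m Xa = X *m Y & Xa *m Ya = Y *m X].

Lemma wadj_mul (K : numClosedFieldType) (m n r : nat) (Wm : 'M[K]_m)
    (Wn : 'M[K]_n) (Wr : 'M[K]_r) (X : 'M[K]_(m, n)) (Y : 'M[K]_(n, r)) :
  Wn \in unitmx -> wadj Wm Wr (X *m Y) = wadj Wn Wr Y *m wadj Wm Wn X.
Proof. by move=> uW; rewrite /wadj trmx_mul map_mxM !mulmxA mulmxK. Qed.

Lemma wMPinv_adjoint_ginv (K : numClosedFieldType) (m n : nat)
    (Wm : 'M[K]_m) (Wn : 'M[K]_n) (X : 'M[K]_(m, n)) (Y : 'M[K]_(n, m)) :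
  Wm \in unitmx -> Wn \in unitmx -> is_wMPinv Wm Wn X Y ->
  adjoint_ginv X Y (wadj Wm Wn X) (wadj Wn Wm Y).
Proof.
move=> uWm uWn [XYX YXY aXY aYX].
have XaYa : wadj Wm Wn X *m wadj Wn Wm Y = Y *m X.
  by rewrite -[RHS]aYX (wadj_mul Wn Wn Y X uWm).
split=> //; last by rewrite -[RHS]aXY (wadj_mul Wm Wm X Y uWn).
by rewrite XaYa -{1}aYX -(wadj_mul Wm Wn X (Y *m X) uWn) mulmxA XYX.
Qed.

Section AdjointGinv.
Variables (F : fieldType) (m n : nat).
Variables (X : 'M[F]_(m, n)) (Y Xa : 'M[F]_(n, m)) (Ya : 'M[F]_(m, n)).
Hypothesis adjXY : adjoint_ginv X Y Xa Ya.

Lemma proj_mul_adj : Y *m X *m Xa = Xa.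
Proof. by have [_ _ ? _ <-] := adjXY. Qed.

Lemma adj_mul_proj : Xa *m (X *m Y) = Xa.
Proof. by have [_ _ ? <- _] := adjXY; rewrite mulmxA. Qed.

(** The product [Ya *m Y *m Ya] of the generalized inverses of the three factors
    is one of [Xa *m X *m Xa]: each factor meets its own inverse in a projector
    that fixes the next factor. *)
Lemma triple_mul_ginv : Xa *m X *m Xa *m (Ya *m Y *m Ya) = Y *m X.
Proof.
have [_ _ _ _ XaYa] := adjXY.
have -> : Xa *m X *m Xa *m (Ya *m Y *m Ya)
    = Xa *m X *m (Xa *m Ya) *m Y *m Ya by rewrite !mulmxA.
have [XYX _ _ _ _] := adjXY.
rewrite XaYa -(mulmxA Xa) (mulmxA X) XYX -(mulmxA Xa).
by rewrite adj_mul_proj XaYa.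
Qed.

Lemma ginv_mul_triple : Ya *m Y *m Ya *m (Xa *m X *m Xa) = X *m Y.
Proof.
have [_ YXY _ YaXa _] := adjXY.
have -> : Ya *m Y *m Ya *m (Xa *m X *m Xa)
    = Ya *m (Y *m (Ya *m Xa) *m X *m Xa) by rewrite !mulmxA.
by rewrite YaXa (mulmxA Y) YXY proj_mul_adj.
Qed.

(** This is how [Y] is recovered from the generalized inverse of the triple
    product: the outer factors turn the two copies of [Ya] into projectors,
    which fix the remaining [Y]. *)
Lemma ginv_sandwich : Xa *m (Ya *m Y *m Ya) *m Xa = Y.
Proof.
have [_ YXY _ YaXa XaYa] := adjXY.
by rewrite !mulmxA XaYa YXY -mulmxA YaXa mulmxA YXY.
Qed.

End AdjointGinv.

(** * The rank formula *)

(** A statement about matrix products alone, in which the involution behind the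
    adjoints has disappeared and any field will do. *)
Lemma rank_bordered (F : fieldType) (p q t s k l : nat)
    (P : 'M[F]_(p, q)) (Pd Pa : 'M_(q, p)) (Pda : 'M_(p, q))
    (Q : 'M[F]_(t, s)) (Qd Qa : 'M_(s, t)) (Qda : 'M_(t, s))
    (A : 'M_(p, s)) (B : 'M_(t, l)) (C : 'M_(k, q)) (D : 'M_(k, l)) :
  adjoint_ginv P Pd Pa Pda -> adjoint_ginv Q Qd Qa Qda ->
  \rank (block_mx
           (block_mx (Pa *m A *m Qa) (Pa *m P *m Pa) (Qa *m Q *m Qa) 0)
           (col_mx 0 (Qa *m B)) (row_mx 0 (C *m Pa)) (- D))
  = (\rank (D - C *m Pd *m A *m Qd *m B)%R + \rank P + \rank Q)%N.
Proof.
move=> hP hQ; have [PPdP _ _ _ _] := hP; have [QQdQ _ _ _ _] := hQ.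
set N := block_mx (Pa *m A *m Qa) _ _ _.
pose GP := Pda *m Pd *m Pda; pose GQ := Qda *m Qd *m Qda.
pose G := antitri_ginv (Pa *m A *m Qa) GP GQ.
have NG : N *m G = block_mx (Pd *m P) 0 0 (Qd *m Q).
  rewrite antitri_mulmx_ginv (triple_mul_ginv hP) ?(triple_mul_ginv hQ) //.
  by rewrite !mulmxA (proj_mul_adj hP).
have GN : G *m N = block_mx (Q *m Qd) 0 0 (P *m Pd).
  rewrite antitri_ginv_mulmx (ginv_mul_triple hQ) ?(ginv_mul_triple hP) //.
  by rewrite -!mulmxA (adj_mul_proj hQ).
have NGN : N *m G *m N = N.
  rewrite NG mulmx_block !(mul0mx, mulmx0, addr0, add0r) !mulmxA.
  by rewrite (proj_mul_adj hP) (proj_mul_adj hQ).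
have rN : \rank N = (\rank P + \rank Q)%N.
  rewrite -(rank_reflexive_mulmx NGN) NG rank_diag_block_mx.
  by rewrite (rank_reflexive_mulmxr PPdP) (rank_reflexive_mulmxr QQdQ).
rewrite (schur_rank (G := G)); first last.
- rewrite -mulmxA GN mul_row_block !(mul0mx, mulmx0, addr0, add0r) -mulmxA.
  by rewrite (adj_mul_proj hP).
- rewrite NG mul_block_col !(mul0mx, mulmx0, addr0, add0r) mulmxA.
  by rewrite (proj_mul_adj hQ).
have -> : - D - row_mx 0 (C *m Pa) *m G *m col_mx 0 (Qa *m B)
    = - (D - C *m Pd *m A *m Qd *m B).
  rewrite mul_row_block mul_row_col !(mul0mx, mulmx0, addr0, add0r).
  rewrite mulmxN mulNmx opprK opprB addrC; congr (_ - _).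
  rewrite -[in RHS](ginv_sandwich hP) -[in RHS](ginv_sandwich hQ).
  by rewrite !mulmxA.
by rewrite mxrank_opp rN addnC addnA.
Qed.

Theorem theorem3p11 (R : realType) (p q t s k l : nat)
    (Wp : 'M[R[i]]_p) (Wq : 'M[R[i]]_q) (Wt : 'M[R[i]]_t) (Ws : 'M[R[i]]_s)
    (P : 'M[R[i]]_(p, q)) (Q : 'M[R[i]]_(t, s)) (A : 'M[R[i]]_(p, s))
    (B : 'M[R[i]]_(t, l)) (C : 'M[R[i]]_(k, q)) (D : 'M[R[i]]_(k, l))
    (Pd : 'M[R[i]]_(q, p)) (Qd : 'M[R[i]]_(s, t))
    (hWp : is_weight Wp) (hWq : is_weight Wq)
    (hWt : is_weight Wt) (hWs : is_weight Ws)
    (hPd : is_wMPinv Wp Wq P Pd) (hQd : is_wMPinv Wt Ws Q Qd) :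
  let Pa := wadj Wp Wq P in
  let Qa := wadj Wt Ws Q in
  (\rank (D - C *m Pd *m A *m Qd *m B))%:Z =
  (\rank (block_mx
            (block_mx (Pa *m A *m Qa)  (Pa *m P *m Pa)
                      (Qa *m Q *m Qa)  (0 : 'M_(s, p)))
            (col_mx (0 : 'M_(q, l)) (Qa *m B))
            (row_mx (0 : 'M_(k, t)) (C *m Pa))
            (- D)))%:Z
  - (\rank P)%:Z - (\rank Q)%:Z.
Proof.
move=> Pa Qa.
have [[_ uWp] [_ uWq] [_ uWt] [_ uWs]] := And4 hWp hWq hWt hWs.
have aP := wMPinv_adjoint_ginv uWp uWq hPd.
have aQ := wMPinv_adjoint_ginv uWt uWs hQd.
by rewrite (rank_bordered A B C D aP aQ) !PoszD [RHS]addrAC !addrK.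
Qed.
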